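(* Let $\Theta\subset\mathbb{R}$ be open and let $\{\rho_\theta\}_{\theta\in\Theta}$ be a smooth one-parameter family of density operators on a finite-dimensional Hilbert space which admits a right logarithmic derivative at $\theta$. Then $$J_{p_\theta}\ge J^{R}_{\rho_\theta}$$ holds for every reverse estimation $(\Phi,\{p_\theta\})$ of $\{\rho_\theta\}$, and there exists a tangent reverse estimation $(\Phi,\{p_\theta,\mathrm{d}p_\theta/\mathrm{d}\theta\})$ of $\{\rho_\theta,\mathrm{d}\rho_\theta/\mathrm{d}\theta\}$ at $\theta$ with $$J_{p_\theta}=J^{R}_{\rho_\theta}.$$
   Context: A right logarithmic derivative (RLD) at $\theta$ is a matrix $L^{R}_\theta$ with $\mathrm{d}\rho_\theta/\mathrm{d}\theta=L^{R}_\theta\rho_\theta$; it exists iff $\mathrm{d}\rho_\theta/\mathrm{d}\theta$ is supported in $\mathrm{supp}\,\rho_\theta$. The RLD Fisher information is $J^{R}_{\rho_\theta}=\mathrm{tr}\,\rho_\theta L_\theta^{R\dagger}L_\theta^{R}$ (independent of the choice of $L^R_\theta$). For a probability distribution $p_\theta$ on a finite set $\mathcal{X}$ with derivative $\mathrm{d}p_\theta/\mathrm{d}\theta$ (a real function on $\mathcal{X}$ with zero sum), the classical Fisher information is $J_{p_\theta}=\sum_x p_\theta(x)\left(\frac{1}{p_\theta(x)}\frac{\mathrm{d}p_\theta(x)}{\mathrm{d}\theta}\right)^2$, where terms with $p_\theta(x)=0$ count as $0$ if $\mathrm{d}p_\theta(x)/\mathrm{d}\theta=0$ and as $+\infty$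 otherwise. A reverse estimation of $\{\rho_\theta\}$ is a pair $(\Phi,\{p_\theta\})$ consisting of a family $\{p_\theta\}$ (differentiable in $\theta$) of probability distributions on a finite set $\mathcal{X}$ and a CPTP (classical-to-quantum) map $\Phi$, i.e. $\Phi(f)=\sum_x f(x)\omega_x$ with fixed density operators $\omega_x$, such that $\Phi(p_\theta)=\rho_\theta$ for all $\theta\in\Theta$. A tangent reverse estimation at the point $\theta$ consists of such a $\Phi$, a probability distribution $p_\theta$, and a zero-sum real function $\mathrm{d}p_\theta/\mathrm{d}\theta$ on $\mathcal{X}$ with $\Phi(p_\theta)=\rho_\theta$ and $\Phi(\mathrm{d}p_\theta/\mathrm{d}\theta)=\mathrm{d}\rho_\theta/\mathrm{d}\theta$ at that $\theta$. *)

(* Defs.v *)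
From HB Require Import structures.
From mathcomp Require Import all_boot all_order all_algebra.
From mathcomp Require Import all_classical all_reals all_analysis.
From mathcomp Require Import complex.

Set Implicit Arguments.
Unset Strict Implicit.
Unset Printing Implicit Defensive.

Import Order.TTheory GRing.Theory Num.Theory.
Import numFieldNormedType.Exports.

Local Open Scope classical_set_scope.
Local Open Scope complex_scope.
Local Open Scope ring_scope.
Local Open Scope sesquilinear_scope.

(* The Hilbert space is C^d with C := R[i]; operators are d x d matrices, and
   A ^t* is the adjoint of A. On R[i], 0 <= z means that z is real and
   nonnegative. *)

Section Quantum.
Variables (R : realType) (d : nat).
Local Notation C := R[i].

Definition psdmx (A : 'M[C]_d) : Prop :=
  A \is hermsymmx /\ forall v : 'cV[C]_d, 0 <= (v ^t* *m A *m v) 0 0.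

Definition density_operator (rho : 'M[C]_d) : Prop :=
  psdmx rho /\ \tr rho = 1.

(* There is no normed R-module structure on R[i] in the libraries, so
   differentiability in the real parameter is that of the real and imaginary
   parts of all the matrix entries. *)
Definition smooth_on (Theta : set R) (f : R -> R) : Prop :=
  forall (k : nat) (t : R), Theta t -> derivable (derive1n k f) t 1.

Definition smooth_family (Theta : set R) (rho : R -> 'M[C]_d) : Prop :=
  forall i j, smooth_on Theta (fun t => complex.Re (rho t i j)) /\
              smooth_on Theta (fun t => complex.Im (rho t i j)).

Definition derive1mx (rho : R -> 'M[C]_d) (t : R) : 'M[C]_d :=
  \matrix_(i, j) (derive1 (fun s => complex.Re (rho s i j)) t +i*
                  derive1 (fun s => complex.Im (rho s i j)) t).

Definition is_rld (rho drho L : 'M[C]_d) : Prop := drho = L *m rho.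

(* A right logarithmic derivative is chosen; the value does not depend on the
   choice (rld_fisherE), and the real part loses nothing (rld_fisher_trE). If
   there is no right logarithmic derivative, the value is a meaningless 0. *)
Definition rld_fisher (rho drho : 'M[C]_d) : R :=
  let L := xget 0 [set L | is_rld rho drho L] in
  complex.Re (\tr (rho *m L ^t* *m L)).

End Quantum.

Section Classical.
Variables (R : realType) (X : finType).

Definition distribution (p : X -> R) : Prop :=
  (forall x, 0 <= p x) /\ \sum_x p x = 1.

Definition classical_fisher (p dp : X -> R) : \bar R :=
  (\sum_x (if (p x == 0)%R then (if (dp x == 0)%R then 0 else +oo)
           else (p x * ((p x)^-1 * dp x) ^+ 2)%:E))%E.

End Classical.

Section ReverseEstimation.
Variables (R : realType) (d : nat) (X : finType).
Local Notation C := R[i].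

(* The classical-to-quantum map f |-> \sum_x f(x) omega_x; it is CPTP when the
   omega_x are density operators. *)
Definition cq_map (omega : X -> 'M[C]_d) (f : X -> R) : 'M[C]_d :=
  \sum_x (f x)%:C *: omega x.

Definition reverse_estimation (Theta : set R) (rho : R -> 'M[C]_d)
    (omega : X -> 'M[C]_d) (p : R -> X -> R) : Prop :=
  [/\ forall x, density_operator (omega x),
      forall t, Theta t -> distribution (p t),
      forall t, Theta t -> forall x, derivable (fun s => p s x) t 1
    & forall t, Theta t -> cq_map omega (p t) = rho t].

Definition tangent_reverse_estimation (rho drho : 'M[C]_d)
    (omega : X -> 'M[C]_d) (p dp : X -> R) : Prop :=
  [/\ forall x, density_operator (omega x),
      distribution p,
      \sum_x dp x = 0,
      cq_map omega p = rho
    & cq_map omega dp = drho].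

End ReverseEstimation.

Section RldFisher.
Variables (R : realType) (d : nat).
Local Notation C := R[i].
Implicit Types rho drho L : 'M[C]_d.

Lemma hermsymmx_adj rho : rho \is hermsymmx -> rho ^t* = rho.
Proof. by move=> /is_hermitianmxP /esym; rewrite expr0 scale1r. Qed.

Lemma adj_mulmx m n q (A : 'M[C]_(m, n)) (B : 'M[C]_(n, q)) :
  (A *m B) ^t* = B ^t* *m A ^t*.
Proof. by rewrite trmx_mul map_mxM. Qed.

Lemma rld_tr_indep rho drho L1 L2 : rho \is hermsymmx ->
  is_rld rho drho L1 -> is_rld rho drho L2 ->
  \tr (rho *m L1 ^t* *m L1) = \tr (rho *m L2 ^t* *m L2).
Proof.
move=> /hermsymmx_adj hrho h1 h2.
have e L : is_rld rho drho L -> rho *m L ^t* = drho ^t*.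
  by move=> ->; rewrite adj_mulmx hrho.
have f L : is_rld rho drho L ->
    \tr (rho *m L ^t* *m L) = \tr (drho *m L2 ^t*).
  by move=> hL; rewrite e // -(e L2 h2) mxtrace_mulC mulmxA -hL.
by rewrite !f.
Qed.

Lemma rld_fisherE rho drho L : rho \is hermsymmx -> is_rld rho drho L ->
  rld_fisher rho drho = complex.Re (\tr (rho *m L ^t* *m L)).
Proof.
move=> hrho hL; rewrite /rld_fisher.
congr (complex.Re _); apply: (rld_tr_indep (drho := drho)) => //.
exact: (@xgetI _ 0 [set M | is_rld rho drho M] L hL).
Qed.

Lemma rld_fisher_trE rho drho L : density_operator rho -> is_rld rho drho L ->
  (rld_fisher rho drho)%:C = \tr (rho *m L ^t* *m L).
Proof.
move=> [[hrho rho_ge0] _] hL; rewrite (rld_fisherE hrho hL).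
suff : 0 <= \tr (rho *m L ^t* *m L).
  by case: (\tr _) => a b /=; rewrite lecE /= => /andP[/eqP -> _].
rewrite mxtrace_mulC mulmxA; apply: sumr_ge0 => i _.
have := rho_ge0 ((row i L) ^t*); rewrite trmxCK -row_mul.
rewrite [X in 0 <= X -> _]mxE; congr (0 <= _); rewrite mxE.
by apply: eq_bigr => j _; rewrite !mxE.
Qed.

End RldFisher.

(* Main.v *)
Require Import Defs.
From mathcomp Require Import all_boot all_order all_algebra.
From mathcomp Require Import all_classical all_reals all_analysis.
From mathcomp Require Import complex.

Import Order.TTheory GRing.Theory Num.Theory.
Import numFieldNormedType.Exports.
Local Open Scope classical_set_scope.
Local Open Scope ring_scope.

(* Lower bound. Put c_x = dp_x / p_x, so that L rho = \sum_x p_x c_x omega_x.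
   Expanding the nonnegative number
     \sum_x p_x tr ((c_x - L) omega_x (c_x - L)^t* )
   gives J_p - T - T + T with T = tr (L rho L^t* ) = J^R.
   Attainment. L rho = drho is Hermitian, so L is symmetric for the form defined
   by rho and there is B with rho = B B^t* whose columns are eigenvectors of L
   for real eigenvalues l_x: L B = B diag(l). The normalized projectors on the
   columns are the omega_x, with p_x the squared norm of column x and
   dp_x = l_x p_x. *)

(** * Trace inequality for the lower bound and eigenvector factorization for attainment *)

Section ClosedField.
Set Implicit Arguments.
Unset Strict Implicit.
Local Open Scope sesquilinear_scope.
Variables (C : numClosedFieldType) (d : nat).

Lemma mx_adjE m n (A : 'M[C]_(m, n)) i j : A^t* i j = (A j i)^*.
Proof. by rewrite !mxE. Qed.

Lemma mx_adjM m n q (A : 'M[C]_(m, n)) (B : 'M[C]_(n, q)) :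
  (A *m B)^t* = B^t* *m A^t*.
Proof. by rewrite trmx_mul map_mxM. Qed.

(** Each diagonal entry of [M *m A *m M^t*] is the value of the form of [A] at the adjoint of a row
    of [M]. *)
Lemma tr_sandwich_ge0 (A M : 'M[C]_d) :
  (forall v : 'cV[C]_d, 0 <= (v^t* *m A *m v) 0 0) ->
  0 <= \tr (M *m A *m M^t*).
Proof.
move=> A_ge0; apply: sumr_ge0 => i _.
have := A_ge0 ((row i M)^t*); rewrite trmxCK -row_mul.
rewrite [X in 0 <= X -> _]mxE; congr (0 <= _); rewrite mxE.
by apply: eq_bigr => j _; rewrite !mxE.
Qed.

Lemma tr_sub_scalar_sandwich (L W : 'M[C]_d) (c : C) : c \is Num.real ->
  \tr ((c%:M - L) *m W *m (c%:M - L)^t*) =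
  c ^+ 2 * \tr W - c * \tr (W *m L^t*) - c * \tr (L *m W)
  + \tr (L *m W *m L^t*).
Proof.
move=> c_real; rewrite !raddfB /= tr_scalar_mx map_scalar_mx /= conj_Creal //.
rewrite !mulmxBl !raddfB /= !mul_scalar_mx !mul_mx_scalar.
rewrite -?scalemxAl -?scalemxAr !linearZ /= expr2 mulrA.
by rewrite opprK addrA (addrAC (c * c * _)).
Qed.

Lemma rld_tr_le (X : finType) (W : X -> 'M[C]_d) (p c : X -> C)
    (rho L : 'M[C]_d) :
  (forall x (v : 'cV[C]_d), 0 <= (v^t* *m W x *m v) 0 0) ->
  (forall x, \tr (W x) = 1) ->
  (forall x, 0 <= p x) -> (forall x, c x \is Num.real) ->
  rho = \sum_x p x *: W x -> L *m rho = \sum_x (p x * c x) *: W x ->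
  L *m rho = rho *m L^t* ->
  \tr (L *m rho *m L^t*) <= \sum_x p x * c x ^+ 2.
Proof.
move=> W_ge0 W_tr p_ge0 c_real rhoE LrhoE Lrho_adj.
set T := \tr _.
have TE : T = \sum_x p x * c x * \tr (W x *m L^t*).
  rewrite /T LrhoE mulmx_suml raddf_sum; apply: eq_bigr => x _ /=.
  by rewrite -scalemxAl linearZ.
have TE' : T = \sum_x p x * c x * \tr (L *m W x).
  rewrite /T -mulmxA -Lrho_adj LrhoE mulmx_sumr raddf_sum.
  apply: eq_bigr => x _ /=.
  by rewrite -scalemxAr linearZ.
have TE'' : T = \sum_x p x * \tr (L *m W x *m L^t*).
  rewrite /T rhoE mulmx_sumr mulmx_suml raddf_sum; apply: eq_bigr => x _ /=.
  by rewrite -scalemxAr -scalemxAl linearZ.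
(* The difference is written as the sum minus T minus T plus T; each copy of T then takes one of the
   three expressions above, which matches the expansion of the square term by term. *)
rewrite -subr_ge0 -[_ - T]addr0 -[X in _ + X](subrr T) addrA addrAC.
rewrite {1}TE {1}TE' {1}TE''.
rewrite -!sumrB -!big_split /=; apply: sumr_ge0 => x _.
have := mulr_ge0 (p_ge0 x) (tr_sandwich_ge0 ((c x)%:M - L) (W_ge0 x)).
by rewrite tr_sub_scalar_sandwich // W_tr mulr1 mulrDr !mulrBr !mulrA.
Qed.

(** Work in an eigenbasis [V] of [rho], with [D] the root of its diagonal form and [L'] the matrix
    of [L]. The symmetry of [L] makes [A], the conjugate of [L'] by [D], Hermitian. A unitary [P]
    diagonalizes [A] with real [l], and B = V^* D P^* works: B B^* = V^* D D V = rho, while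
    [D *m A = L' *m D] gives the eigenvector equation. *)
Lemma exists_eigenvector_factor (rho L : 'M[C]_d) : rho \is hermsymmx ->
  (forall v : 'cV[C]_d, 0 <= (v^t* *m rho *m v) 0 0) ->
  L *m rho = rho *m L^t* ->
  exists (B : 'M[C]_d) (l : 'rV[C]_d),
    [/\ forall i, l 0 i \is Num.real,
        rho = B *m B^t*
      & L *m B = B *m diag_mx l].
Proof.
move=> rho_herm rho_ge0 Lrho.
have /orthomx_spectralP := hermitian_normalmx rho_herm.
have V_unitary := spectral_unitarymx rho.
set V := spectralmx rho in V_unitary *; set r := spectral_diag rho.
rewrite (invmx_unitary V_unitary) => rhoE.
have VVt : V *m V^t* = 1%:M by apply/unitarymxP.
have VtV : V^t* *m V = 1%:M by apply: mulmx1C.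
have rE : V *m rho *m V^t* = diag_mx r.
  by rewrite rhoE -!mulmxA VVt mulmx1 !mulmxA VVt mul1mx.
have r_ge0 i : 0 <= r 0 i.
  have := rho_ge0 ((row i V)^t*); rewrite trmxCK -row_mul.
  have -> : r 0 i = diag_mx r i i by rewrite mxE eqxx.
  rewrite -rE [X in _ -> 0 <= X]mxE [X in 0 <= X -> _]mxE; congr (0 <= _).
  by apply: eq_bigr => j _; rewrite !mxE.
pose s i := sqrtC (r 0 i).
have s_real i : (s i)^* = s i by rewrite conj_Creal // ger0_real // sqrtC_ge0.
have sr i : s i * s i = r 0 i by rewrite -expr2 sqrtCK.
pose D := diag_mx (\row_i s i).
have D_adj : D^t* = D.
  rewrite tr_diag_mx map_diag_mx; congr diag_mx.
  by apply/rowP => i; rewrite !mxE /= s_real.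
have DD : D *m D = diag_mx r.
  by rewrite mulmx_diag; congr diag_mx; apply/rowP => i; rewrite !mxE sr.
(* [L'] is introduced as an opaque matrix, so that its entries stay atomic under [mxE]. *)
have [L' L'E] : {M | M = V *m L *m V^t*} by eexists.
have L'r : L' *m diag_mx r = diag_mx r *m L'^t*.
  rewrite L'E !mx_adjM trmxCK -rE !mulmxA.
  by rewrite !(mulmxKtV _ V_unitary erefl) -[V *m L *m rho]mulmxA Lrho !mulmxA.
have L'rE i j : L' i j * r 0 j = r 0 i * (L' j i)^*.
  have := congr1 (fun M : 'M[C]_d => M i j) L'r.
  by rewrite mul_mx_diag mul_diag_mx !mxE.
(* sqrt(rho)^-1 L sqrt(rho) in the eigenbasis of rho; as 1/0 = 0, the inverse is
   that on the support of rho. *)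
pose A : 'M[C]_d := \matrix_(i, j) (L' i j * s j / s i).
(* [L] maps the support of [rho] into itself: [L'rE] with [r 0 i] zero kills row i on the support.
   Hence the convention 1/0 = 0 does not spoil [D *m A = L' *m D]. *)
have L's0 i j : s i = 0 -> L' i j * s j = 0.
  move=> si; have [->|sj] := eqVneq (s j) 0; first by rewrite mulr0.
  apply: (mulIf sj); rewrite mul0r -mulrA sr L'rE -sr si.
  by rewrite !mul0r.
have DA : D *m A = L' *m D.
  rewrite mul_diag_mx mul_mx_diag; apply/matrixP => i j; rewrite !mxE.
  have [si|si] := eqVneq (s i) 0; first by rewrite si mul0r L's0.
  by rewrite mulrC divfK.
have A_herm : A \is hermsymmx.
  apply/is_hermitianmxP; rewrite expr0 scale1r; apply/matrixP => i j.
  rewrite !mxE.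
  rewrite !rmorphM fmorphV /= !s_real.
  have [si|si] := eqVneq (s i) 0; first by rewrite si L's0 // mulr0 !mul0r.
  have [sj|sj] := eqVneq (s j) 0; first by rewrite sj mulr0 invr0 mulr0 mul0r.
  (* Clearing the nonzero denominators [s i] and [s j] leaves exactly [L'rE]. *)
  apply: (mulIf sj); apply: (mulIf si); rewrite divfK // mulrAC divfK //.
  by rewrite -!mulrA sr L'rE -sr mulrC mulrA.
have /orthomx_spectralP := hermitian_normalmx A_herm.
have /mxOverP l_real := hermitian_spectral_diag_real A_herm.
have P_unitary := spectral_unitarymx A.
set P := spectralmx A in P_unitary *; set l := spectral_diag A in l_real *.
rewrite (invmx_unitary P_unitary) => AE.
have PPt : P *m P^t* = 1%:M by apply/unitarymxP.
have PtP : P^t* *m P = 1%:M by apply: mulmx1C.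
exists (V^t* *m D *m P^t*), l; split => //.
  rewrite !mx_adjM !trmxCK D_adj !mulmxA (mulmxKtV _ P_unitary erefl).
  by rewrite -[_ *m D *m D]mulmxA DD.
have -> : L *m (V^t* *m D *m P^t*) = V^t* *m (L' *m D) *m P^t*.
  by rewrite L'E !mulmxA VtV mul1mx.
by rewrite -DA AE -!mulmxA PPt mulmx1.
Qed.

Lemma mulmx_diag_adj (B : 'M[C]_d) (l : 'rV[C]_d) :
  B *m diag_mx l *m B^t* = \sum_x l 0 x *: (col x B *m (col x B)^t*).
Proof.
apply/matrixP => i j; rewrite mxE summxE; apply: eq_bigr => x _.
by rewrite mul_mx_diag !mxE big_ord1 !mxE mulrA [B i x * _]mulrC.
Qed.

End ClosedField.

(** * The Fisher information bound and its attainment at a fixed parameter *)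

Section Fisher.
Set Implicit Arguments.
Unset Strict Implicit.
Local Open Scope sesquilinear_scope.
Local Open Scope complex_scope.
Variables (R : realType) (d : nat).
Local Notation C := R[i].

Lemma conjC_real_complex (r : R) : (r%:C)^*%R = r%:C.
Proof. by rewrite conj_Creal // complex_real. Qed.

Lemma cq_map_adj (X : finType) (omega : X -> 'M[C]_d) (f : X -> R) :
  (forall x, omega x \is hermsymmx) -> (cq_map omega f)^t* = cq_map omega f.
Proof.
move=> omega_herm; rewrite /cq_map.
rewrite linear_sum /= raddf_sum; apply: eq_bigr => x _.
by rewrite linearZ /= map_mxZ /= hermsymmx_adj // conjC_real_complex.
Qed.

Lemma cq_map_tr (X : finType) (omega : X -> 'M[C]_d) (f : X -> R) :
  (forall x, \tr (omega x) = 1) -> \tr (cq_map omega f) = (\sum_x f x)%:C.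
Proof.
move=> omega_tr; rewrite /cq_map raddf_sum rmorph_sum /=.
by apply: eq_bigr => x _; rewrite linearZ /= omega_tr mulr1.
Qed.

Lemma psdmx_mulmx_adj n (B : 'M[C]_(d, n)) : psdmx (B *m B^t*).
Proof.
split=> [|v].
  by apply/is_hermitianmxP; rewrite expr0 scale1r mx_adjM trmxCK.
have -> : v^t* *m (B *m B^t*) *m v = (v^t* *m B) *m (v^t* *m B)^t*.
  by rewrite mx_adjM trmxCK !mulmxA.
by rewrite mxE; apply: sumr_ge0 => j _; rewrite mx_adjE mul_conjC_ge0.
Qed.

Lemma psdmxZ (a : R) (A : 'M[C]_d) : 0 <= a -> psdmx A -> psdmx (a%:C *: A).
Proof.
move=> a_ge0 [A_herm A_ge0]; split=> [|v].
  apply/is_hermitianmxP; rewrite expr0 scale1r linearZ /= map_mxZ /=.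
  by rewrite hermsymmx_adj // conjC_real_complex.
by rewrite -scalemxAr -scalemxAl mxE mulr_ge0 // ler0c.
Qed.

Lemma classical_fisher_fin (X : finType) (p dp : X -> R) :
  (forall x, p x = 0 -> dp x = 0) ->
  classical_fisher p dp = (\sum_x p x * (dp x / p x) ^+ 2)%:E.
Proof.
move=> dp0; rewrite /classical_fisher -sumEFin; apply: eq_bigr => x _.
case: eqP => [px|_]; last by rewrite [(p x)^-1 * _]mulrC.
by rewrite dp0 // eqxx px mul0r.
Qed.

Lemma classical_fisher_infty (X : finType) (p dp : X -> R) x :
  (forall x, 0 <= p x) -> p x = 0 -> dp x != 0 -> classical_fisher p dp = +oo%E.
Proof.
move=> p_ge0 px dpx; apply/eqP; rewrite -leye_eq.
rewrite /classical_fisher (bigD1 x) //=.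
(* The infinite term absorbs the others because their sum is nonnegative, hence not [-oo]. *)
rewrite px eqxx (negPf dpx) addye // gt_eqF // (@lt_le_trans _ _ 0%E) //.
apply: sume_ge0 => y _; do 2?[case: ifP => // _].
by rewrite lee_fin mulr_ge0 // sqr_ge0.
Qed.

Lemma rld_comm (rho drho L : 'M[C]_d) :
  rho^t* = rho -> drho^t* = drho -> is_rld rho drho L -> L *m rho = rho *m L^t*.
Proof.
by move=> rho_adj drho_adj hL; rewrite -hL -drho_adj hL mx_adjM rho_adj.
Qed.

Lemma rld_fisher_le_classical (X : finType) (omega : X -> 'M[C]_d)
    (p dp : X -> R) (rho drho L : 'M[C]_d) :
  (forall x, density_operator (omega x)) -> density_operator rho ->
  (forall x, 0 <= p x) -> cq_map omega p = rho -> cq_map omega dp = drho ->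
  is_rld rho drho L ->
  ((rld_fisher rho drho)%:E <= classical_fisher p dp)%E.
Proof.
move=> omegaD rhoD p_ge0 rhoE drhoE hL.
(* If [dp] is nonzero somewhere off the support of [p], the classical information is infinite and
   the bound is trivial; otherwise it is a finite sum. *)
have [/existsP[x /andP[/eqP px dpx]]|/existsPn no_infty] :=
  boolP [exists x, (p x == 0) && (dp x != 0)].
  by rewrite (classical_fisher_infty p_ge0 px dpx) // leey.
have dp0 x : p x = 0 -> dp x = 0.
  by move=> px; have := no_infty x; rewrite px eqxx negbK => /eqP.
rewrite classical_fisher_fin // lee_fin -lecR (rld_fisher_trE rhoD hL).
(* Also for p x = 0, as dp x / 0 = 0. *)
have pc x : p x * (dp x / p x) = dp x.
  have [px|px] := eqVneq (p x) 0; last by rewrite mulrC divfK.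
  by rewrite px mul0r dp0.
have rho_adj : rho^t* = rho by case: rhoD => -[/hermsymmx_adj].
have omega_herm x : omega x \is hermsymmx by case: (omegaD x) => -[].
have drho_adj : drho^t* = drho by rewrite -drhoE cq_map_adj.
have Lrho := rld_comm rho_adj drho_adj hL.
rewrite mxtrace_mulC mulmxA rmorph_sum /=.
under eq_bigr do rewrite rmorphM rmorphXn /=.
apply: (rld_tr_le (W := omega) (p := fun x => (p x)%:C)
  (c := fun x => (dp x / p x)%:C)) => //.
- by move=> x; case: (omegaD x) => -[].
- by move=> x; case: (omegaD x).
- by move=> x; rewrite ler0c.
- by move=> x; rewrite complex_real.
- rewrite -hL -drhoE; apply: eq_bigr => x _.
  by rewrite -rmorphM /= pc.
Qed.

Lemma exists_tangent_reverse_estimation (rho drho L : 'M[C]_d) :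
  density_operator rho -> drho^t* = drho -> \tr drho = 0 -> is_rld rho drho L ->
  exists (X : finType) (omega : X -> 'M[C]_d) (p dp : X -> R),
    tangent_reverse_estimation rho drho omega p dp /\
    classical_fisher p dp = (rld_fisher rho drho)%:E.
Proof.
move=> rhoD drho_adj drho_tr hL.
have [[rho_herm rho_ge0] rho_tr] := rhoD.
have Lrho := rld_comm (hermsymmx_adj rho_herm) drho_adj hL.
have [B [l [l_real rhoE LB]]] := exists_eigenvector_factor rho_herm rho_ge0 Lrho.
pose lam x := complex.Re (l 0 x).
have lE x : l 0 x = (lam x)%:C by rewrite RRe_real.
pose b x := col x B.
pose p x := complex.Re (\tr (b x *m (b x)^t*)).
have bb_tr x : \tr (b x *m (b x)^t*) = \sum_i b x i 0 * (b x i 0)^*.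
  by apply: eq_bigr => i _; rewrite mxE big_ord1 mx_adjE.
have bb_ge0 x : 0 <= \tr (b x *m (b x)^t*).
  by rewrite bb_tr sumr_ge0 // => i _; rewrite mul_conjC_ge0.
have pE x : (p x)%:C = \tr (b x *m (b x)^t*) by rewrite RRe_real // ger0_real.
have p_ge0 x : 0 <= p x by rewrite -ler0c pE.
have b0 x : p x = 0 -> b x = 0.
  move=> px; have := pE x; rewrite px bb_tr => /esym/eqP.
  rewrite psumr_eq0 => [/allP bx0|i _]; last by rewrite mul_conjC_ge0.
  apply/colP => i; rewrite [RHS]mxE; apply/eqP.
  by have := bx0 i (mem_index_enum i); rewrite /= mul_conjC_eq0.
(* When [p x] is 0 the column [b x] vanishes and any density operator serves; [rho] is one at
   hand. *)
pose omega x := if p x == 0 then rho else (p x)^-1%:C *: (b x *m (b x)^t*).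
have omegaD x : density_operator (omega x).
  rewrite /omega; case: eqP => // /eqP px; split.
    by apply: psdmxZ; [rewrite invr_ge0 | exact: psdmx_mulmx_adj].
  by rewrite linearZ /= -pE -rmorphM /= mulVf.
have omega_tr x : \tr (omega x) = 1 by case: (omegaD x).
have p_omega x : (p x)%:C *: omega x = b x *m (b x)^t*.
  rewrite /omega; case: eqP => [px|/eqP px].
    by rewrite px scale0r b0 // mul0mx.
  by rewrite scalerA -rmorphM /= divff // scale1r.
(* This one identity is used three times: f = 1 gives [rho], f = [lam] gives [drho], and the square
   of [lam] gives [L *m rho *m L^t*]. *)
have cqE (f : 'I_d -> R) :
    B *m diag_mx (\row_x (f x)%:C) *m B^t* = cq_map omega (fun x => f x * p x).
  rewrite mulmx_diag_adj; apply: eq_bigr => x _.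
  by rewrite mxE rmorphM -scalerA p_omega.
have l_row : l = \row_x (lam x)%:C by apply/rowP => x; rewrite mxE.
have drhoE : drho = cq_map omega (fun x => lam x * p x).
  by rewrite hL rhoE mulmxA LB l_row cqE.
have rho_cq : rho = cq_map omega p.
  rewrite rhoE -[X in X *m _]mulmx1 -[1%:M]diag_const_mx.
  have -> : const_mx 1 = \row_x (1 : R)%:C :> 'rV[C]_d.
    by apply/rowP => x; rewrite !mxE.
  by rewrite (cqE (fun=> 1)); apply: eq_bigr => x _; rewrite mul1r.
exists 'I_d, omega, p, (fun x => lam x * p x); split; first split=> //.
(* The two sums are traces: that of [rho], equal to 1, and that of [drho], equal to 0. *)
- split=> //; apply: (@complexI R).
  by rewrite -(cq_map_tr _ omega_tr) -rho_cq.
- by apply: (@complexI R); rewrite -(cq_map_tr _ omega_tr) -drhoE.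
rewrite classical_fisher_fin; last by move=> x ->; rewrite mulr0.
congr (_%:E); apply: (@complexI R).
rewrite (rld_fisher_trE rhoD hL) mxtrace_mulC mulmxA.
have -> : L *m rho *m L^t* = cq_map omega (fun x => (lam x ^+ 2) * p x).
  rewrite -cqE rhoE mulmxA LB -[LHS]mulmxA -mx_adjM LB l_row mx_adjM.
  rewrite tr_diag_mx map_diag_mx /= mulmxA.
  rewrite -[_ *m _ *m diag_mx _]mulmxA mulmx_diag.
  congr (_ *m diag_mx _ *m _); apply/rowP => x.
  by rewrite !mxE /= conjC_real_complex -rmorphM.
rewrite (cq_map_tr _ omega_tr); congr (_%:C); apply: eq_bigr => x _.
have [px|px] := eqVneq (p x) 0; first by rewrite px !mulr0 mul0r.
by rewrite mulfK // mulrC.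
Qed.
End Fisher.

(** * Entrywise derivatives of matrix families *)

Section Derivatives.
Set Implicit Arguments.
Unset Strict Implicit.
Local Open Scope sesquilinear_scope.
Local Open Scope complex_scope.
Variables (R : realType) (d : nat).
Local Notation C := R[i].

Lemma derive1_near_eq (f g : R -> R) (t : R) :
  (\forall s \near t, f s = g s) -> derive1 f t = derive1 g t.
Proof. by move=> fg; rewrite !derive1E; exact: near_eq_derive. Qed.

Lemma derive1_sum (X : finType) (f : X -> R -> R) (t : R) :
  (forall x, derivable (f x) t 1) ->
  derive1 (fun s => \sum_x f x s) t = \sum_x derive1 (f x) t.
Proof.
move=> f_der.
(* Stating [is_derive] over an arbitrary list lets the induction carry derivability along with the
   value. *)
suff /(_ (index_enum X)) [_ fE] : forall r : seq X,
    is_derive t 1 (fun s => \sum_(x <- r) f x s)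
      (\sum_(x <- r) derive1 (f x) t).
  by rewrite derive1E.
elim=> [|x r IHr].
  rewrite big_nil (_ : (fun _ => _) = cst 0); first exact: is_derive_cst.
  by apply/funext => s; rewrite big_nil.
rewrite big_cons (_ : (fun _ => _) = f x + (fun s => \sum_(y <- r) f y s)).
  by apply: is_deriveD; rewrite derive1E; exact: derivableP.
by apply/funext => s; rewrite big_cons.
Qed.

Lemma ReM_real (a : R) (z : C) : complex.Re (a%:C * z) = a * complex.Re z.
Proof. by case: z => x y /=; rewrite mul0r subr0. Qed.

Lemma ImM_real (a : R) (z : C) : complex.Im (a%:C * z) = a * complex.Im z.
Proof. by case: z => x y /=; rewrite mul0r addr0. Qed.

Lemma Re_sum (X : finType) (F : X -> C) :
  complex.Re (\sum_x F x) = \sum_x complex.Re (F x).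
Proof. by apply: (big_morph (@complex.Re R)) => // -[? ?] [? ?]. Qed.

Lemma Im_sum (X : finType) (F : X -> C) :
  complex.Im (\sum_x F x) = \sum_x complex.Im (F x).
Proof. by apply: (big_morph (@complex.Im R)) => // -[? ?] [? ?]. Qed.

Lemma derive1_sum_mulr (X : finType) (p : R -> X -> R) (a : X -> R) (t : R) :
  (forall x, derivable (fun s => p s x) t 1) ->
  derive1 (fun s => \sum_x p s x * a x) t =
  \sum_x derive1 (fun s => p s x) t * a x.
Proof.
move=> p_der.
have pa x : (fun s => p s x * a x) = a x \*: (fun s => p s x).
  by apply/funext => s; rewrite /= mulrC.
rewrite derive1_sum => [|x]; last by rewrite pa; exact: derivableZ.
by apply: eq_bigr => x _; rewrite pa !derive1E deriveZ // mulrC.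
Qed.

(** Real and imaginary parts of each entry are real combinations of the [p s x] with constant
    coefficients. This passes from a reverse estimation to its tangent data. *)
Lemma derive1mx_cq_map (X : finType) (omega : X -> 'M[C]_d) (p : R -> X -> R)
    (rho : R -> 'M[C]_d) (t : R) :
  (\forall s \near t, cq_map omega (p s) = rho s) ->
  (forall x, derivable (fun s => p s x) t 1) ->
  derive1mx rho t = cq_map omega (fun x => derive1 (fun s => p s x) t).
Proof.
move=> rhoE p_der; apply/matrixP => i j; rewrite mxE summxE.
apply/eqP; rewrite eq_complex /= Re_sum Im_sum; apply/andP; split; apply/eqP.
  under eq_bigr do rewrite mxE ReM_real.
  rewrite -derive1_sum_mulr //; apply: derive1_near_eq.
  near=> s; rewrite -(near rhoE s) // summxE Re_sum.
  by apply: eq_bigr => x _; rewrite mxE ReM_real.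
under eq_bigr do rewrite mxE ImM_real.
rewrite -derive1_sum_mulr //; apply: derive1_near_eq.
near=> s; rewrite -(near rhoE s) // summxE Im_sum.
by apply: eq_bigr => x _; rewrite mxE ImM_real.
Unshelve. all: by end_near. Qed.

(** Near [t] the real parts form a symmetric matrix and the imaginary parts an antisymmetric one;
    differentiation preserves both. *)
Lemma derive1mx_adj (rho : R -> 'M[C]_d) (t : R) :
  (forall i j, derivable (fun s => complex.Im (rho s i j)) t 1) ->
  (\forall s \near t, (rho s)^t* = rho s) ->
  (derive1mx rho t)^t* = derive1mx rho t.
Proof.
move=> rho_der rho_adj; apply/matrixP => i j; rewrite mx_adjE !mxE.
have rhoJ : \forall s \near t, rho s i j = (rho s j i)^*%R.
  by near=> s; rewrite -[in LHS](near rho_adj s) // mx_adjE.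
apply/eqP; rewrite eq_complex /=; apply/andP; split; apply/eqP.
  apply: derive1_near_eq; near=> s; rewrite (near rhoJ s) //.
  by case: (rho s j i).
rewrite !derive1E -deriveN // -!derive1E.
apply: derive1_near_eq; near=> s; rewrite (near rhoJ s) //.
by rewrite fctE; case: (rho s j i).
Unshelve. all: by end_near. Qed.

Lemma derive1mx_tr (rho : R -> 'M[C]_d) (t : R) (c : C) :
  (forall i j, derivable (fun s => complex.Re (rho s i j)) t 1) ->
  (forall i j, derivable (fun s => complex.Im (rho s i j)) t 1) ->
  (\forall s \near t, \tr (rho s) = c) -> \tr (derive1mx rho t) = 0.
Proof.
move=> Re_der Im_der rho_tr; apply/eqP; rewrite eq_complex Re_sum Im_sum /=.
under eq_bigr do rewrite mxE /=.
under [X in _ && (X == _)]eq_bigr do rewrite mxE /=.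
rewrite -!derive1_sum //; apply/andP; split; apply/eqP.
  rewrite -[RHS](derive1_cst (complex.Re c) t); apply: derive1_near_eq.
  by near=> s; rewrite /cst -(near rho_tr s) // Re_sum.
rewrite -[RHS](derive1_cst (complex.Im c) t); apply: derive1_near_eq.
by near=> s; rewrite /cst -(near rho_tr s) // Im_sum.
Unshelve. all: by end_near. Qed.
End Derivatives.

(** * From the family to its tangent data at the given parameter *)

Theorem theorem3p4 (R : realType) (d : nat) (Theta : set R)
    (rho : R -> 'M[R[i]]_d) (theta : R)
    (open_Theta : open Theta)
    (rho_density : forall t, Theta t -> density_operator (rho t))
    (rho_smooth : smooth_family Theta rho)
    (Theta_theta : Theta theta)
    (rld_exists : exists L, is_rld (rho theta) (derive1mx rho theta) L) :
  (forall (X : finType) (omega : X -> 'M[R[i]]_d) (p : R -> X -> R),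
      reverse_estimation Theta rho omega p ->
      ((rld_fisher (rho theta) (derive1mx rho theta))%:E <=
       classical_fisher (p theta)
         (fun x => derive1 (fun t => p t x) theta))%E) /\
  (exists (X : finType) (omega : X -> 'M[R[i]]_d) (p dp : X -> R),
      tangent_reverse_estimation (rho theta) (derive1mx rho theta) omega p dp /\
      classical_fisher p dp =
        (rld_fisher (rho theta) (derive1mx rho theta))%:E).
Proof.
have [L hL] := rld_exists.
(* Openness makes identities valid on [Theta] hold in a neighbourhood, so that they can be
   differentiated. *)
have near_Theta : \forall t \near theta, Theta t by exact: open_nbhs_nbhs.
have rhoD := rho_density _ Theta_theta.
split=> [X omega p [omegaD p_dist p_der rhoE]|].
  have [p_ge0 _] := p_dist _ Theta_theta.
  apply: (rld_fisher_le_classical omegaD rhoD p_ge0 (rhoE _ Theta_theta) _ hL).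
  apply/esym/derive1mx_cq_map; last exact: p_der.
  by apply: filterS near_Theta.
(* Order 0 in [smooth_on] is derivability of the function itself. *)
have Re_der i j : derivable (fun s => complex.Re (rho s i j)) theta 1.
  by have [/(_ 0%N theta Theta_theta)] := rho_smooth i j.
have Im_der i j : derivable (fun s => complex.Im (rho s i j)) theta 1.
  by have [_ /(_ 0%N theta Theta_theta)] := rho_smooth i j.
apply: (exists_tangent_reverse_estimation rhoD _ _ hL).
  apply: derive1mx_adj => //; apply: filterS near_Theta => t.
  by move=> /rho_density[[/hermsymmx_adj]].
apply: (derive1mx_tr Re_der Im_der (c := 1)); apply: filterS near_Theta => t.
by case/rho_density.
Qed.
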